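(* Let $L_0,L_1\ge0$ be not both zero, let $G(s)=L_0+L_1\,s$ for $s\ge0$, let $d\ge1$ and $c>1$. Then for every $\sigma>0$, $$\mathcal{K}^{(c)}_{d,\sigma}(G)=c\,\varphi\left(L_1\,\sigma\,(c\,d)^{1/2}\right)\,\max\left\{L_0\,d\,\sigma^2,\ L_1\,d\,\sigma\right\},$$ where $\varphi(u)=u^{-2}\{\exp(u)-1-u\}$ for $u>0$ and $\varphi(0)=1/2$. Consequently, for every $\eta$ with $$0<\eta\le\eta_c:=\min\left\{c^{-1/2},\ \frac{1}{4\,c\,(\exp(1)-2)}\right\},$$ the proposal scale $\sigma=\eta\,\min\left\{(L_0\,d)^{-1/2},\,(L_1\,d)^{-1}\right\}$ (with $1/0=+\infty$) satisfies $\mathcal{K}^{(c)}_{d,\sigma}(G)\le1/4$.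
   Context: For a continuous nondecreasing $G\colon[0,\infty)\to[0,\infty)$ and $r,s\ge0$, $\Gamma(r,s)$ is the value at time $r$ of the maximal (i.e. pointwise largest) nonnegative solution of $\dot\gamma=G(\gamma)$, $\gamma(0)=s$. Set $\overline{G}(r,s)=2\int_0^1(1-t)\,G(\Gamma(t\,r,s))\,\mathrm{d}t$ and, for $r,\sigma>0$, $\mathcal{K}_{r,\sigma}(G)=\frac{r^2}{2}\,\sup\left\{\frac{\overline{G}(r,s)}{1+\sigma\,s}:s\ge0\right\}$. For $c>1$, $d\ge 1$, $\sigma>0$, $\mathcal{K}^{(c)}_{d,\sigma}(G)$ denotes $\mathcal{K}_{r,\sigma}(G)$ with $r=\sigma\,(c\,d)^{1/2}$. *)

(* Defs.v *)
From HB Require Import structures.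
From mathcomp Require Import all_boot all_order all_algebra.
From mathcomp Require Import all_classical all_reals all_analysis.

Set Implicit Arguments.
Unset Strict Implicit.
Unset Printing Implicit Defensive.

Import Order.TTheory GRing.Theory Num.Theory.
Import numFieldNormedType.Exports.

Local Open Scope classical_set_scope.
Local Open Scope ring_scope.

(* Functions on [0, +oo[ are represented by total functions R -> R; only their
   values at nonnegative reals are ever used. *)

(* As G is continuous, continuity on [0, T] together with the equation on
   ]0, T[ also gives the one-sided equations at 0 and at T. *)
Definition nonneg_solution (R : realType) (G : R -> R) (T s : R)
    (gamma : R -> R) : Prop :=
  [/\ gamma 0 = s,
      {within `[0, T], continuous gamma},
      (forall t, 0 <= t <= T -> 0 <= gamma t) &
      (forall t, 0 < t < T -> is_derive t (1 : R) gamma (G (gamma t)))].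

Definition maximal_solution (R : realType) (G : R -> R) (T s : R)
    (gamma : R -> R) : Prop :=
  nonneg_solution G T s gamma /\
  (forall delta, nonneg_solution G T s delta ->
    forall t, 0 <= t <= T -> delta t <= gamma t).

(* The set below has at most one element; it is empty when the maximal solution
   explodes before or at time r, and Gamma is then +oo. *)
Definition Gamma (R : realType) (G : R -> R) (r s : R) : \bar R :=
  xget +oo%E
    [set x | exists2 gamma, maximal_solution G r s gamma & x = (gamma r)%:E].

(* er_map sends +oo to +oo, which is the limit of G at +oo whenever Gamma takes
   the value +oo, since a bounded G admits no explosion. *)
Definition Gbar (R : realType) (G : R -> R) (r s : R) : \bar R :=
  (2%:E * \int[lebesgue_measure]_(t in `[0%R, 1%R])
            ((1 - t)%:E * er_map G (Gamma G (t * r) s)))%E.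

Definition calK (R : realType) (r sigma : R) (G : R -> R) : \bar R :=
  ((r ^+ 2 / 2)%:E *
   ereal_sup [set (Gbar G r s / (1 + sigma * s)%:E)%E | s in `[0%R, +oo[])%E.

Definition calKc (R : realType) (c : R) (d : nat) (sigma : R) (G : R -> R) :
    \bar R :=
  calK (sigma * Num.sqrt (c * d%:R)) sigma G.

Definition phi (R : realType) (u : R) : R :=
  if u == 0 then 1 / 2 else u ^- 2 * (expR u - 1 - u).

Definition eta_c (R : realType) (c : R) : R :=
  Num.min (Num.sqrt c)^-1 (1 / (4 * c * (expR 1 - 2))).

(* The inverses are taken in \bar R, where 0^-1 = +oo; the minimum is finite
   unless L0 * d = L1 * d = 0. *)
Definition proposal_scale (R : realType) (L0 L1 : R) (d : nat) (eta : R) : R :=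
  eta * fine (Order.min ((Num.sqrt (L0 * d%:R))%:E^-1) ((L1 * d%:R)%:E^-1))%E.

(* Main.v *)
(* For affine [G], [G (Gamma G t s) = (L0 + L1 * s) * expR (L1 * t)], so that
   [Gbar G r s = 2 * (L0 + L1 * s) * phi (L1 * r)], since [phi u] is the integral
   of [(1 - t) * expR (u * t)] over [0, 1].  Only the quotient
   [(L0 + L1 * s) / (1 + sigma * s)] is left to maximise over [s].  The integral
   formula also makes [phi] nondecreasing; as the proposal scale satisfies
   [L1 * sigma * sqrt (c * d) <= 1], the bound [1 / 4] follows from
   [phi 1 = e - 2]. *)

Require Import Defs.
From mathcomp Require Import all_boot all_order all_algebra.
From mathcomp Require Import all_classical all_reals all_analysis.
From mathcomp Require Import measurable_realfun ring lra.

Set Implicit Arguments.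
Unset Strict Implicit.
Unset Printing Implicit Defensive.

Import Order.TTheory GRing.Theory Num.Theory.
Import numFieldNormedType.Exports.
Local Open Scope ring_scope.

(** * Derivatives and primitives of exponentials *)

Lemma derive_within_continuous (R : realType) (f df : R -> R) (A : set R) :
  (forall t : R, is_derive t (1 : R) f (df t)) ->
  {within A, continuous f}%classic.
Proof.
move=> Df; apply: continuous_subspaceT => t.
apply: differentiable_continuous; apply/derivable1_diffP.
exact: (@ex_derive _ _ _ _ _ _ _ (Df t)).
Qed.

Lemma is_derive_expR_scale (R : realType) (a t : R) :
  is_derive t (1 : R) (fun t => expR (a * t)) (a * expR (a * t)).
Proof.
apply: is_derive_eq.
by rewrite /GRing.scale /= ; ring.
Qed.

(* The primitive of [t |-> expR (a * t)] vanishing at 0. *)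
Definition expR_prim (R : realType) (a t : R) : R :=
  if a == 0 then t else (expR (a * t) - 1) / a.

Lemma expR_prim0 (R : realType) (a : R) : expR_prim a 0 = 0.
Proof.
by rewrite /expR_prim; case: eqP => // _; rewrite mulr0 expR0 subrr mul0r.
Qed.

(** This form covers [a = 0] as well, so that the later computations need no case split on whether
    [L1] vanishes. *)
Lemma expR_primE (R : realType) (a t : R) : 1 + a * expR_prim a t = expR (a * t).
Proof.
rewrite /expR_prim; case: eqVneq => [->|a0]; first by rewrite !mul0r expR0 addr0.
by field.
Qed.

Lemma expR_prim_ge0 (R : realType) (a t : R) :
  0 <= a -> 0 <= t -> 0 <= expR_prim a t.
Proof.
move=> a0 t0; rewrite /expR_prim; case: ifPn => // _.
by rewrite divr_ge0// subr_ge0 -expR0 ler_expR mulr_ge0.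
Qed.

Lemma is_derive_expR_prim (R : realType) (a t : R) :
  is_derive t (1 : R) (expR_prim a) (expR (a * t)).
Proof.
rewrite /expR_prim; case: eqVneq => [->|a0].
  by rewrite mul0r expR0; exact: is_derive_id.
have De := is_derive_expR_scale a t.
have -> : (fun t => (expR (a * t) - 1) / a) =
          (fun t => a^-1 * (expR (a * t) - 1)) by apply/funext => x; rewrite mulrC.
apply: is_derive_eq.
by rewrite /GRing.scale /= subr0 mulrA mulVf // mul1r.
Qed.

(** * The differential equation with affine right-hand side *)

(** For [L1 != 0] this is the usual [(s + L0 / L1) * expR (L1 * t) - L0 / L1]; going through
    [expR_prim] includes the linear flow [s + L0 * t] of the case [L1 = 0]. *)
Definition affine_flow (R : realType) (L0 L1 s t : R) : R :=
  s + (L0 + L1 * s) * expR_prim L1 t.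

Lemma is_derive_affine_flow (R : realType) (L0 L1 s t : R) :
  is_derive t (1 : R) (affine_flow L0 L1 s) (L0 + L1 * affine_flow L0 L1 s t).
Proof.
have De := is_derive_expR_prim L1 t.
apply: is_derive_eq.
rewrite /GRing.scale /= -expR_primE /affine_flow; ring.
Qed.

Lemma affine_flow_ge0 (R : realType) (L0 L1 s t : R) :
  0 <= L0 -> 0 <= L1 -> 0 <= s -> 0 <= t -> 0 <= affine_flow L0 L1 s t.
Proof.
move=> L00 L10 s0 t0.
by rewrite /affine_flow addr_ge0// mulr_ge0 ?expR_prim_ge0// addr_ge0// mulr_ge0.
Qed.

(** Integrating factor: the difference of two solutions times [expR (- L1 * x)] has zero derivative,
    so by the mean value theorem it keeps its initial value 0. *)
Lemma affine_ode_unique (R : realType) (L0 L1 T s : R) (f g : R -> R) :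
  f 0 = s -> g 0 = s ->
  {within `[0, T], continuous f}%classic ->
  {within `[0, T], continuous g}%classic ->
  (forall t, 0 < t < T -> is_derive t (1 : R) f (L0 + L1 * f t)) ->
  (forall t, 0 < t < T -> is_derive t (1 : R) g (L0 + L1 * g t)) ->
  forall t, 0 <= t <= T -> f t = g t.
Proof.
move=> f0 g0 cf cg Df Dg t /andP[t0 tT].
pose e (x : R) := expR (- L1 * x).
pose h (x : R) := e x * (f x - g x).
have De x : is_derive x (1 : R) e (- L1 * e x) by exact: is_derive_expR_scale.
have ce : {within `[0, t], continuous e}%classic.
  exact: (@derive_within_continuous _ _ (fun x => - L1 * e x)).
have sub : (`[0, t] `<=` `[0, T])%classic.
  by move=> x /=; rewrite !in_itv /= => /andP[-> xt]; exact: le_trans tT.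
have ch : {within `[0, t], continuous h}%classic.
  have := continuous_subspaceW sub cg; have := continuous_subspaceW sub cf.
  move=> cf' cg' x; apply: cvgM; first exact: ce.
  by apply: cvgB; [exact: cf'|exact: cg'].
have Dh x : x \in `]0, t[ -> is_derive x (1 : R) h 0.
  rewrite in_itv /= => /andP[x0 xt].
  have xT : 0 < x < T by rewrite x0 (lt_le_trans xt).
  have Dfx := Df _ xT; have Dgx := Dg _ xT; have Dex := De x.
  apply: is_derive_eq.
  rewrite /GRing.scale /=; ring.
have [z _] := MVT_segment t0 (df := fun=> 0) Dh ch.
rewrite mul0r /h f0 g0 subrr mulr0 subr0 => /eqP.
by rewrite mulf_eq0 gt_eqF ?expR_gt0 //= subr_eq0 => /eqP.
Qed.

Section AffineField.
Variables (R : realType) (L0 L1 : R) (G : R -> R).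
Hypotheses (L0_ge0 : 0 <= L0) (L1_ge0 : 0 <= L1).
Hypothesis GE : forall s, 0 <= s -> G s = L0 + L1 * s.

(** A nonnegative solution stays where [G] is affine, so uniqueness forces it to equal the flow;
    maximality then holds with equality. *)
Lemma maximal_affine_flow (T s : R) : 0 <= s ->
  maximal_solution G T s (affine_flow L0 L1 s).
Proof.
move=> s0; split.
  split.
  - by rewrite /affine_flow expR_prim0 mulr0 addr0.
  - exact: (derive_within_continuous (is_derive_affine_flow L0 L1 s)).
  - by move=> t /andP[t0 _]; exact: affine_flow_ge0.
  - move=> t /andP[t0 _]; have t0' := ltW t0; rewrite GE ?affine_flow_ge0//.
    exact: is_derive_affine_flow.
move=> delta [delta0 cdelta delta_ge0 Ddelta] t tT.
suff -> : delta t = affine_flow L0 L1 s t by [].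
apply: (@affine_ode_unique _ L0 L1 T s) tT => //.
- by rewrite /affine_flow expR_prim0 mulr0 addr0.
- exact: (derive_within_continuous (is_derive_affine_flow L0 L1 s)).
- move=> x /[dup] xT /andP[x0 xlt]; rewrite -GE; first exact: Ddelta.
  by apply: delta_ge0; rewrite !ltW.
- by move=> x _; exact: is_derive_affine_flow.
Qed.

(** Two maximal solutions dominate each other at time [r], so the set from which [xget] chooses is a
    singleton. *)
Lemma Gamma_affine (r s : R) : 0 <= r -> 0 <= s ->
  Gamma G r s = (affine_flow L0 L1 s r)%:E.
Proof.
move=> r0 s0; have [sol max] := maximal_affine_flow r s0.
apply: xget_unique => [|_ [g [gsol gmax] ->]].
  by exists (affine_flow L0 L1 s).
have rr : 0 <= r <= r by rewrite r0 lexx.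
by congr EFin; apply/le_anti; rewrite max // gmax.
Qed.

End AffineField.

(** * Integral representation and monotonicity of [phi] *)

Lemma integral_phi (R : realType) (u : R) :
  (\int[lebesgue_measure]_(t in `[0%R, 1%R]) ((1 - t) * expR (u * t))%:E)%E =
  (phi u)%:E.
Proof.
(* A primitive of the integrand, found through integration by parts when [u != 0]. *)
pose F (t : R) := if u == 0 then t - t ^+ 2 / 2
  else (1 - t) * (expR (u * t) / u) + expR (u * t) / u ^+ 2.
have De t := is_derive_expR_scale u t.
have DF (t : R) : is_derive t (1 : R) F ((1 - t) * expR (u * t)).
  rewrite /F; case: eqVneq => [->|u0].
    apply: is_derive_eq.
    by rewrite mul0r expR0 /GRing.scale /=; field.
  apply: is_derive_eq.
  by rewrite /GRing.scale /=; field.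
rewrite (@continuous_FTC2 _ _ F) //.
- rewrite -EFinB /F /phi; congr EFin; case: eqVneq => [_|u0].
    by field.
  by rewrite mulr0 mulr1 expR0; field.
- apply: (@derive_within_continuous _ _
    (fun t => (1 - t) * (u * expR (u * t)) - expR (u * t))) => t.
  apply: is_derive_eq.
  by rewrite /GRing.scale /=; ring.
- have cF (t : R) : {for t, continuous F}.
    apply: differentiable_continuous; apply/derivable1_diffP.
    exact: (@ex_derive _ _ _ _ _ _ _ (DF t)).
  split; first by move=> t _; exact: (@ex_derive _ _ _ _ _ _ _ (DF t)).
    exact: cvg_at_right_filter (cF _).
  exact: cvg_at_left_filter (cF _).
- by move=> t _; rewrite derive1E; exact: (@derive_val _ _ _ _ _ _ _ (DF t)).
Qed.

Lemma measurable_onem_expR (R : realType) (u : R) (A : set R) :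
  measurable_fun A (fun t : R => (1 - t) * expR (u * t) : R).
Proof.
apply: measurable_funS (@measurableT _ _) (@subsetT _ _) _.
apply: measurable_funM; first exact: measurable_funB.
by apply: measurableT_comp => //; exact: measurable_funM.
Qed.

Lemma phi_ge0 (R : realType) (u : R) : 0 <= phi u.
Proof.
rewrite -lee_fin -integral_phi; apply: integral_ge0 => t /=.
rewrite in_itv /= => /andP[t0 t1].
by rewrite lee_fin mulr_ge0 ?expR_ge0 ?subr_ge0.
Qed.

(** In the integral formula the integrands are already ordered pointwise, because [t] and [1 - t]
    are nonnegative on the unit interval. *)
Lemma le_phi (R : realType) : {homo @phi R : u v / u <= v}.
Proof.
move=> u v uv; rewrite -lee_fin -!integral_phi.
apply: ge0_le_integral => //.
- move=> t /=; rewrite in_itv /= => /andP[t0 t1].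
  by rewrite lee_fin mulr_ge0 ?expR_ge0 ?subr_ge0.
- by apply/measurable_EFinP; exact: measurable_onem_expR.
- by apply/measurable_EFinP; exact: measurable_onem_expR.
- move=> t /=; rewrite in_itv /= => /andP[t0 t1].
  by rewrite lee_fin ler_wpM2l ?subr_ge0 // ler_expR ler_wpM2r.
Qed.

Lemma phi1 (R : realType) : phi (1 : R) = expR 1 - 2.
Proof. by rewrite /phi oner_eq0; field. Qed.

(** * Closed forms of [Gbar], [calK] and [calKc] for affine [G] *)

Lemma Gbar_affine (R : realType) (L0 L1 : R) (G : R -> R) (r s : R) :
  0 <= L0 -> 0 <= L1 -> (forall s, 0 <= s -> G s = L0 + L1 * s) ->
  0 <= r -> 0 <= s ->
  Gbar G r s = (2 * (L0 + L1 * s) * phi (L1 * r))%:E.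
Proof.
move=> L00 L10 GE r0 s0; rewrite /Gbar.
(* Along the flow, [L0 + L1 * affine_flow L0 L1 s t] equals [(L0 + L1 * s) * (1 + L1 * expR_prim L1
   t)], which [expR_primE] turns into a pure exponential. *)
rewrite [X in (_ * X)%E](_ : _ = \int[lebesgue_measure]_(t in `[0%R, 1%R])
    ((L0 + L1 * s)%:E * ((1 - t) * expR (L1 * r * t))%:E))%E; last first.
  apply: eq_integral => t; rewrite inE /= in_itv /= => /andP[t0 t1].
  have tr0 : 0 <= t * r by rewrite mulr_ge0.
  rewrite (@Gamma_affine _ L0 L1) //= GE ?affine_flow_ge0 // -!EFinM.
  congr EFin; rewrite -mulrA [r * t]mulrC -expR_primE /affine_flow; ring.
rewrite ge0_integralZl_EFin //.
- by rewrite integral_phi -!EFinM mulrA.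
- move=> t /=; rewrite in_itv /= => /andP[t0 t1].
  by rewrite lee_fin mulr_ge0 ?expR_ge0 ?subr_ge0.
- by apply/measurable_EFinP; exact: measurable_onem_expR.
- by rewrite addr_ge0 // mulr_ge0.
Qed.

(* The quotient is a weighted mean of [L0], its value at [s = 0], and
   [L1 / sigma], its limit as [s] tends to infinity. *)
Lemma ereal_sup_affine_quotient (R : realType) (L0 L1 sigma : R) : 0 < sigma ->
  ereal_sup [set ((L0 + L1 * s) / (1 + sigma * s))%:E | s in `[0%R, +oo[]%classic =
  (Num.max L0 (L1 / sigma))%:E.
Proof.
move=> sg0; have den s : 0 <= s -> 0 < 1 + sigma * s.
  by move=> s0; rewrite ltr_pwDl // mulr_ge0 // ltW.
apply/le_anti/andP; split.
  apply: ge_ereal_sup => _ [s /= + <-]; rewrite in_itv /= andbT => s0.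
  rewrite lee_fin ler_pdivrMr ?den // mulrDr mulr1 lerD ?le_max ?lexx //.
  by rewrite mulrA ler_wpM2r // -ler_pdivrMr // le_max lexx orbT.
set S := ereal_sup _.
have ubS s : 0 <= s -> (((L0 + L1 * s) / (1 + sigma * s))%:E <= S)%E.
  by move=> s0; apply: ereal_sup_ubound; exists s => //=; rewrite in_itv /= s0.
have : (L0%:E <= S)%E.
  by have := ubS 0 (lexx _); rewrite !mulr0 !addr0 divr1.
(* The lower bound [L0] excludes the value -oo, and for +oo the inequality is immediate. *)
case: S ubS => [m| |] // ubS; last by rewrite !leey.
rewrite !lee_fin => L0m; rewrite ge_max L0m /=.
rewrite leNgt; apply/negP; rewrite ltr_pdivlMr // => mL1.
have gap : 0 < L1 - m * sigma by rewrite subr_gt0.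
(* The upper bound [m] on the quotient at [s] means [s * (L1 - m * sigma) <= m - L0]; this [s] makes
   the left side [m - L0 + 1], a contradiction. *)
pose s := (m - L0 + 1) / (L1 - m * sigma).
have s0 : 0 <= s by rewrite divr_ge0 ?(ltW gap) // addr_ge0 // subr_ge0.
have := ubS s s0; rewrite lee_fin ler_pdivrMr ?den //.
have : s * (L1 - m * sigma) = m - L0 + 1 by rewrite divfK ?gt_eqF.
move=> sE; nra.
Qed.

Lemma calK_affine (R : realType) (L0 L1 : R) (G : R -> R) (r sigma : R) :
  0 <= L0 -> 0 <= L1 -> (forall s, 0 <= s -> G s = L0 + L1 * s) ->
  0 <= r -> 0 < sigma ->
  calK r sigma G = (r ^+ 2 * phi (L1 * r) * Num.max L0 (L1 / sigma))%:E.
Proof.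
move=> L00 L10 GE r0 sg0; rewrite /calK.
set X := (X in ereal_sup X).
have -> : X = [set ((2 * phi (L1 * r))%:E * x)%E | x in
    [set ((L0 + L1 * s) / (1 + sigma * s))%:E | s in `[0%R, +oo[]]%classic.
  rewrite /X image_comp; apply: eq_imagel => s /=.
  rewrite in_itv /= andbT => s0.
  have den : 1 + sigma * s != 0.
    by rewrite gt_eqF // ltr_pwDl // mulr_ge0 // ltW.
  rewrite (@Gbar_affine _ L0 L1) // inver (negbTE den) -!EFinM.
  by congr EFin; ring.
rewrite ereal_supZl.
- by rewrite ereal_sup_affine_quotient // -!EFinM; congr EFin; field.
- apply/set0P; exists (L0)%:E; exists 0 => /=; first by rewrite in_itv /= lexx.
  by rewrite !mulr0 !addr0 divr1.
- by rewrite mulr_ge0 // phi_ge0.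
Qed.

Lemma calKc_affine (R : realType) (L0 L1 : R) (G : R -> R) (d : nat)
    (c sigma : R) :
  0 <= L0 -> 0 <= L1 -> (forall s, 0 <= s -> G s = L0 + L1 * s) ->
  0 <= c -> 0 < sigma ->
  calKc c d sigma G =
    (c * phi (L1 * sigma * Num.sqrt (c * d%:R)) *
     Num.max (L0 * d%:R * sigma ^+ 2) (L1 * d%:R * sigma))%:E.
Proof.
move=> L00 L10 GE c0 sg0; have sg_ge0 := ltW sg0.
rewrite /calKc (@calK_affine _ L0 L1) //; last by rewrite mulr_ge0 ?sqrtr_ge0.
have -> : Num.max (L0 * d%:R * sigma ^+ 2) (L1 * d%:R * sigma) =
    d%:R * sigma ^+ 2 * Num.max L0 (L1 / sigma).
  rewrite maxr_pMr ?mulr_ge0 ?sqr_ge0 //.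
  by congr Num.max; [ring|field; rewrite gt_eqF].
rewrite exprMn sqr_sqrtr ?mulr_ge0 // mulrA.
by congr EFin; ring.
Qed.

(** * The proposal scale and the bound 1/4 *)

(** The factor [eta] scales out, which leaves the case [eta = 1]; the infinite inverses are dealt
    with here once and for all. *)
Lemma proposal_scale_spec (R : realType) (L0 L1 : R) (d : nat) (eta : R) :
  0 <= L0 -> 0 <= L1 -> ~ (L0 = 0 /\ L1 = 0) -> (0 < d)%N -> 0 < eta ->
  let sigma := proposal_scale L0 L1 d eta in
  [/\ 0 < sigma, L0 * d%:R * sigma ^+ 2 <= eta ^+ 2 & L1 * d%:R * sigma <= eta].
Proof.
move=> L00 L10 L01 d0 eta0.
have d0R : 0 < d%:R :> R by rewrite ltr0n.
rewrite /proposal_scale; set m := fine _.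
suff [m0 a b] : [/\ 0 < m, L0 * d%:R * m ^+ 2 <= 1 & L1 * d%:R * m <= 1].
  split; first exact: mulr_gt0.
  - by rewrite exprMn mulrCA -[leRHS]mulr1 ler_wpM2l ?sqr_ge0.
  - by rewrite mulrCA -[leRHS]mulr1 ler_wpM2l // ltW.
rewrite /m !inver sqrtr_eq0 !mulf_eq0 (gt_eqF d0R) orbF.
have H0 y : 0 < L0 -> 0 <= y -> y <= (Num.sqrt (L0 * d%:R))^-1 -> L0 * d%:R * y ^+ 2 <= 1.
  move=> L0p y0 yle; have ld : 0 < L0 * d%:R by exact: mulr_gt0.
  rewrite mulrC -ler_pdivlMr // mul1r -[leRHS]sqr_sqrtr ?invr_ge0 ?(ltW ld) //.
  by rewrite ler_sqr ?nnegrE ?sqrtr_ge0 // sqrtrV // ltW.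
have H1 y : 0 < L1 -> y <= (L1 * d%:R)^-1 -> L1 * d%:R * y <= 1.
  move=> L1p yle; have ld : 0 < L1 * d%:R by exact: mulr_gt0.
  by rewrite mulrC -ler_pdivlMr // mul1r.
have s0 : 0 < L0 -> 0 < (Num.sqrt (L0 * d%:R))^-1.
  by move=> L0p; rewrite invr_gt0 sqrtr_gt0 mulr_gt0.
have s1 : 0 < L1 -> 0 < (L1 * d%:R)^-1.
  by move=> L1p; rewrite invr_gt0 mulr_gt0.
(* A vanishing coefficient contributes +oo, so the minimum is the other entry; at least one entry is
   finite by hypothesis. *)
have [L0z|L0n] := eqVneq L0 0; have [L1z|L1n] := eqVneq L1 0.
- by case: L01.
- have L1p : 0 < L1 by rewrite lt_def L1n.
  rewrite L0z mul0r lexx minye /= mul0r ler01; split => //; [exact: s1|exact: H1].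
- have L0p : 0 < L0 by rewrite lt_def L0n.
  rewrite leNgt mulr_gt0 //= miney /= L1z !mul0r ler01.
  by split => //; [exact: s0|exact: (H0 _ L0p (ltW (s0 L0p)))].
- have L1p : 0 < L1 by rewrite lt_def L1n.
  have L0p : 0 < L0 by rewrite lt_def L0n.
  rewrite leNgt mulr_gt0 //= -EFin_min /=; split.
  + by rewrite lt_min s0 ?s1.
  + by apply: H0 => //; rewrite ?le_min ?ge_min ?lexx // !ltW ?s0 ?s1.
  + by apply: H1 => //; rewrite ge_min lexx orbT.
Qed.

Theorem mainTheorem4 (R : realType) (L0 L1 : R) (G : R -> R) (d : nat) (c : R)
    (hL0 : 0 <= L0) (hL1 : 0 <= L1) (hL : ~ (L0 = 0 /\ L1 = 0))
    (hG : forall s : R, 0 <= s -> G s = L0 + L1 * s)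
    (hd : (1 <= d)%N) (hc : 1 < c) :
  (forall sigma : R, 0 < sigma ->
    calKc c d sigma G =
    (c * phi (L1 * sigma * Num.sqrt (c * d%:R)) *
     Num.max (L0 * d%:R * sigma ^+ 2) (L1 * d%:R * sigma))%:E) /\
  (forall eta : R, 0 < eta -> eta <= eta_c c ->
    (calKc c d (proposal_scale L0 L1 d eta) G <= (1 / 4)%:E)%E).
Proof.
have c0 : 0 < c by exact: lt_trans hc.
split=> [sigma sg0|eta eta0]; first by apply: calKc_affine => //; exact: ltW.
rewrite /eta_c le_min => /andP[eta_c1 eta_c2].
have [sg0 bnd0 bnd1] := proposal_scale_spec hL0 hL1 hL hd eta0.
set sigma := proposal_scale _ _ _ _ in sg0 bnd0 bnd1 *.
rewrite (@calKc_affine _ L0 L1) ?(ltW c0) // lee_fin.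
have sc0 : 0 < Num.sqrt c by rewrite sqrtr_gt0.
have eta_sc : eta * Num.sqrt c <= 1 by rewrite -ler_pdivlMr // mul1r.
have eta1 : eta <= 1.
  by apply: le_trans eta_c1 _; rewrite invf_le1 // -sqrtr1 ler_sqrt // ltW.
have d1 : 1 <= d%:R :> R by rewrite ler1n.
(* Since [d >= 1], [Num.sqrt d] is at most [d], so the argument of [phi] is at most
   [eta * Num.sqrt c], which the first entry of [eta_c] keeps below 1. *)
have u1 : L1 * sigma * Num.sqrt (c * d%:R) <= 1.
  rewrite sqrtrM ?(ltW c0) //.
  have sd : Num.sqrt d%:R <= d%:R :> R.
    by rewrite -[leRHS]ger0_norm // -sqrtr_sqr ler_sqrt ?sqr_ge0 // expr2 ler_peMl.
  have : L1 * sigma * (Num.sqrt c * Num.sqrt d%:R) <=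
         L1 * sigma * (Num.sqrt c * d%:R).
    apply: ler_wpM2l; first by rewrite mulr_ge0 // ltW.
    by apply: ler_wpM2l => //; exact: ltW.
  move/le_trans; apply.
  have : L1 * d%:R * sigma * Num.sqrt c <= eta * Num.sqrt c.
    by rewrite ler_wpM2r // ltW.
  lra.
have phile : phi (L1 * sigma * Num.sqrt (c * d%:R)) <= expR 1 - 2.
  by rewrite -phi1; exact: le_phi.
(* As [eta <= 1], the quadratic bound [eta ^+ 2] is absorbed by the linear one. *)
have maxle : Num.max (L0 * d%:R * sigma ^+ 2) (L1 * d%:R * sigma) <= eta.
  rewrite ge_max bnd1 andbT (le_trans bnd0) // expr2.
  by apply: ler_piMr => //; exact: ltW.
have e2 : 0 < expR 1 - 2 :> R.
  by rewrite subr_gt0 (_ : 2 = 1 + 1) // expR_gt1Dx // oner_eq0.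
(* That this product is at most 1/4 is exactly the constraint from the second entry of [eta_c]. *)
apply: (@le_trans _ _ (c * (expR 1 - 2) * eta)).
  apply: ler_pM => //; first by rewrite mulr_ge0 ?phi_ge0 // ltW.
    by rewrite le_max; apply/orP; left; rewrite mulr_ge0 ?sqr_ge0 // mulr_ge0.
  by rewrite ler_wpM2l // ltW.
have den0 : 0 < 4 * c * (expR 1 - 2) by rewrite !mulr_gt0.
move: eta_c2; rewrite ler_pdivlMr // => H; lra.
Qed.
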